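(* Let $f_{nd\_para}(n)$ denote the maximum number of points one can choose from the grid $[1,n]^2$ without forming a non-degenerate parallelogram. Then for every positive integer $n$, $$f_{nd\_para}(n)=2n-1.$$
   Context: Here $[1,n]=\{1,2,\dots,n\}$ is an integer interval, so $[1,n]^2$ is the $n\times n$ integer grid in the plane. A parallelogram in the grid is a quadruple of distinct points $(x_1,y_1),(x_2,y_2),(x_3,y_3),(x_4,y_4)$ satisfying $(x_1,y_1)+(x_3,y_3)=(x_2,y_2)+(x_4,y_4)$; it is non-degenerate if the four points are not collinear (collinear solutions of this equation are permitted in the chosen set). *)

(* Defs.v *)
From mathcomp Require Import all_boot all_order all_algebra.
From mathcomp Require Import boolp.

Set Implicit Arguments.
Unset Strict Implicit.
Unset Printing Implicit Defensive.

Import GRing.Theory.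

Local Open Scope ring_scope.

(* 'I_n is {0, ..., n-1}: the shift by one identifies 'I_n * 'I_n with the    *)
(* grid [1,n]^2 inside Z^2.                                                   *)
Definition grid_point (n : nat) (p : 'I_n * 'I_n) : int * int :=
  ((p.1).+1%:Z, (p.2).+1%:Z).

(* Integer coefficients lose nothing: a real line through two distinct points *)
(* of Z^2 has an equation with integer coefficients.                          *)
Definition collinear (s : seq (int * int)) : Prop :=
  exists a b c : int, (a, b) <> (0, 0) /\
    forall p, p \in s -> a * p.1 + b * p.2 = c.

Definition parallelogram (p1 p2 p3 p4 : int * int) : Prop :=
  uniq [:: p1; p2; p3; p4] /\ p1 + p3 = p2 + p4.

Definition nd_parallelogram (p1 p2 p3 p4 : int * int) : Prop :=
  parallelogram p1 p2 p3 p4 /\ ~ collinear [:: p1; p2; p3; p4].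

Definition nd_para_free (n : nat) (A : {set 'I_n * 'I_n}) : Prop :=
  ~ exists p1 p2 p3 p4 : 'I_n * 'I_n,
      [/\ p1 \in A, p2 \in A, p3 \in A & p4 \in A] /\
      nd_parallelogram (grid_point p1) (grid_point p2)
                       (grid_point p3) (grid_point p4).

Definition f_nd_para (n : nat) : nat :=
  (\max_(A : {set 'I_n * 'I_n} | `[< nd_para_free A >]) #|A|)%N.

(* Main.v *)
(** Upper bound: in every occupied column ([p.1] fixed) take the lowest chosen
    point.  There are at most [n] of these, and every other chosen point has a
    height in [1, n-1] above the lowest point of its column.  Two points with
    the same height lie in different columns, so together with the two lowest
    points they span a non-degenerate parallelogram; hence at most [n-1] further
    points.  Lower bound: the union of one row and one column. *)
Require Import Defs.
From mathcomp Require Import all_boot.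
From mathcomp Require Import all_order all_algebra boolp zify.

Set Implicit Arguments.
Unset Strict Implicit.
Unset Printing Implicit Defensive.

(** When [p \in A], the seed [p] is itself a candidate, so the minimum is attained. *)
Definition column_lowest (n : nat) (A : {set 'I_n * 'I_n}) (p : 'I_n * 'I_n) :
    'I_n * 'I_n :=
  [arg min_(q < p | (q \in A) && (q.1 == p.1)) q.2].

Lemma column_lowestP n (A : {set 'I_n * 'I_n}) p : p \in A ->
  [/\ column_lowest A p \in A, (column_lowest A p).1 = p.1
    & forall q, q \in A -> q.1 = p.1 -> (column_lowest A p).2 <= q.2].
Proof.
move=> pA; rewrite /column_lowest; case: arg_minnP => [|q].
  by rewrite pA eqxx.
case/andP=> qA /eqP q1 qmin; split=> // r rA r1.
by apply: qmin; rewrite rA r1 eqxx.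
Qed.

Lemma column_lowest_eq n (A : {set 'I_n * 'I_n}) p q :
    p \in A -> q \in A -> p.1 = q.1 ->
  column_lowest A p = column_lowest A q.
Proof.
move=> pA qA pq.
have [lpA lp1 lpmin] := column_lowestP pA.
have [lqA lq1 lqmin] := column_lowestP qA.
apply/eqP; rewrite -pair_eqE /pair_eq lp1 lq1 pq eqxx /=.
apply/eqP/val_inj/eqP; rewrite eqn_leq lpmin ?lqmin //.
  by rewrite lp1.
by rewrite lq1.
Qed.

(** A column has only one lowest point, so [fst] is injective on these points. *)
Lemma card_column_lowest n (A : {set 'I_n * 'I_n}) :
  #|[set p in A | p == column_lowest A p]| <= n.
Proof.
rewrite -[X in _ <= X]card_ord -(card_in_imset (f := fst)) ?max_card //.
move=> p q; rewrite !inE => /andP[pA /eqP ->] /andP[qA /eqP ->].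
have [_ -> _] := column_lowestP pA.
have [_ -> _] := column_lowestP qA.
exact: column_lowest_eq.
Qed.

Lemma column_lowest_lt n (A : {set 'I_n * 'I_n}) p :
    p \in A -> p != column_lowest A p ->
  (column_lowest A p).2 < p.2.
Proof.
move=> pA; have [_ lp1 lpmin] := column_lowestP pA.
rewrite -pair_eqE /pair_eq lp1 eqxx /= => p2.
by rewrite ltn_neqAle lpmin // andbT eq_sym.
Qed.

Lemma vertical_sides_nd_parallelogram n (p q r s : 'I_n * 'I_n) :
    p.1 = q.1 -> r.1 = s.1 -> p.1 != r.1 -> p.2 < q.2 ->
    p.2 + s.2 = q.2 + r.2 ->
  nd_parallelogram (grid_point p) (grid_point q) (grid_point s) (grid_point r).
Proof.
case: p q r s => [p1 p2] [q1 q2] [r1 r2] [s1 s2] /= <- <- pr pq sumE.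
have {}pr : nat_of_ord p1 != r1 by [].
split; first split.
- rewrite /= !inE -!pair_eqE /pair_eq /=; lia.
- by rewrite /grid_point /=; congr pair => /=; lia.
case=> a [b [c [ab0 line]]]; apply: ab0.
have := line (grid_point (p1, p2)); rewrite !inE eqxx => /(_ isT) /= e1.
have := line (grid_point (p1, q2)); rewrite !inE eqxx orbT => /(_ isT) /= e2.
have := line (grid_point (r1, r2)); rewrite !inE eqxx !orbT => /(_ isT) /= e3.
(* Two points of one column force [b = 0]; a third point in another column then forces [a = 0]. *)
have b0 : b = 0%R by nia.
have a0 : a = 0%R by subst b; nia.
by rewrite a0 b0.
Qed.

Lemma nd_para_free_card n (A : {set 'I_n.+1 * 'I_n.+1}) :
  nd_para_free A -> #|A| <= n.+1 + n.
Proof.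
move=> freeA.
rewrite -(cardsID [set p | p == column_lowest A p]).
apply: leq_add.
  rewrite (_ : A :&: _ = [set p in A | p == column_lowest A p]).
    exact: card_column_lowest.
  by apply/setP => p; rewrite !inE.
(* Heights are at most [n], so [inord] keeps their values. *)
pose height (p : 'I_n.+1 * 'I_n.+1) : 'I_n.+1 :=
  inord (p.2 - (column_lowest A p).2).
have heightE p : height p = p.2 - (column_lowest A p).2 :> nat.
  by rewrite inordK // (leq_ltn_trans (leq_subr _ _)).
rewrite -(card_in_imset (f := height)).
  (* Away from the lowest points heights are nonzero, which lowers the count from [n.+1] to [n]. *)
  apply: (@leq_trans #|[set~ (ord0 : 'I_n.+1)]|); last first.
    by rewrite cardsC1 card_ord.
  apply/subset_leq_card/subsetP => _ /imsetP[p + ->].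
  rewrite !inE => /andP[low pA]; have := column_lowest_lt pA low.
  by rewrite -val_eqE /= heightE; lia.
move=> p q; rewrite !inE => /andP[plow pA] /andP[qlow qA].
move=> /(congr1 val) /=; rewrite !heightE => hE.
have ltp := column_lowest_lt pA plow; have ltq := column_lowest_lt qA qlow.
have [lpA lp1 _] := column_lowestP pA.
have [lqA lq1 _] := column_lowestP qA.
(* In one column both heights start from the same lowest point, so equal heights give equal points;
   distinct columns give a forbidden parallelogram. *)
have [pq1|pq1] := eqVneq p.1 q.1.
  apply/eqP; rewrite -pair_eqE /pair_eq pq1 eqxx /=.
  move: hE ltp ltq; rewrite (column_lowest_eq pA qA pq1) -val_eqE /=; lia.
case: freeA.
exists (column_lowest A p), p, q, (column_lowest A q); split=> //.
apply: vertical_sides_nd_parallelogram => //; first by rewrite lp1 lq1.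
have addE (a b c d : nat) : a < b -> c < d -> b - a = d - c -> a + d = b + c.
  by lia.
exact: addE.
Qed.

(** The row and column meet in a corner of the grid: a cross centred in the interior would contain a
    rhombus. *)
Definition axes_cross (n : nat) : {set 'I_n.+1 * 'I_n.+1} :=
  setX [set ord0] setT :|: setX setT [set ord0].

Lemma card_axes_cross n : #|axes_cross n| = n.+1 + n.
Proof.
rewrite cardsU.
have -> : setX [set ord0] setT :&: setX setT [set ord0]
          = setX [set ord0] [set ord0] :> {set 'I_n.+1 * 'I_n.+1}.
  by apply/setP => -[x y]; rewrite !inE andbT.
rewrite !cardsX !cards1 cardsT card_ord; lia.
Qed.

(** Say [x1 = 0]. If [x3 = 0], then [x2 + x4 = 0] and all first coordinates vanish. Otherwise
    [y3 = 0] and [y1 = y2 + y4]; unless all second coordinates vanish, the first point coincides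
    with the second or the fourth. *)
Lemma axes_cross_sum_eq x1 y1 x2 y2 x3 y3 x4 y4 :
    (x1 == 0) || (y1 == 0) -> (x2 == 0) || (y2 == 0) ->
    (x3 == 0) || (y3 == 0) -> (x4 == 0) || (y4 == 0) ->
    x1 + x3 = x2 + x4 -> y1 + y3 = y2 + y4 ->
    (x1, y1) <> (x2, y2) -> (x1, y1) <> (x4, y4) ->
  [/\ x1 = 0, x2 = 0, x3 = 0 & x4 = 0] \/ [/\ y1 = 0, y2 = 0, y3 = 0 & y4 = 0].
Proof.
move=> c1 c2 c3 c4 sx sy n12 n14.
have neq_coord (x y x' y' : nat) : (x, y) <> (x', y') -> x <> x' \/ y <> y'.
  have [->|/eqP] := eqVneq x x'; last by left.
  by move=> ne; right=> yE; apply: ne; rewrite yE.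
move/neq_coord: n12 => n12; move/neq_coord: n14 => n14.
case/orP: c1 => /eqP ?; case/orP: c2 => /eqP ?; case/orP: c3 => /eqP ?;
  case/orP: c4 => /eqP ?; subst; by [left; split; lia | right; split; lia].
Qed.

Lemma axes_cross_nd_para_free n : nd_para_free (axes_cross n).
Proof.
case=> -[x1 y1] [[x2 y2] [[x3 y3] [[x4 y4] [[]]]]].
rewrite !inE /= !andbT -!val_eqE /= => c1 c2 c3 c4 [[uniqP sumE] ncol].
move: (congr1 fst sumE) (congr1 snd sumE) => /= sx sy.
have [n12 n14] : (x1 : nat, y1 : nat) <> (x2 : nat, y2 : nat)
              /\ (x1 : nat, y1 : nat) <> (x4 : nat, y4 : nat).
  by split=> -[ex ey]; move: uniqP; rewrite /grid_point /= ex ey !inE eqxx ?orbT.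
have {}sx : x1 + x3 = x2 + x4 by lia.
have {}sy : y1 + y3 = y2 + y4 by lia.
have [[h1 h2 h3 h4]|[h1 h2 h3 h4]] :=
  axes_cross_sum_eq c1 c2 c3 c4 sx sy n12 n14; apply: ncol.
(* Index 0 stands for coordinate 1, so the common line is [x = 1] here and [y = 1] in the other
   case. *)
- exists 1%R, 0%R, 1%R; split=> // p.
  by rewrite !inE /grid_point /= h1 h2 h3 h4 => /or4P[] /eqP -> /=; lia.
- exists 0%R, 1%R, 1%R; split=> // p.
  by rewrite !inE /grid_point /= h1 h2 h3 h4 => /or4P[] /eqP -> /=; lia.
Qed.

Theorem proposition3p5 (n : nat) (hn : 0 < n) : f_nd_para n = 2 * n - 1.
Proof.
case: n hn => // n _.
have -> : 2 * n.+1 - 1 = n.+1 + n by lia.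
apply/eqP; rewrite eqn_leq; apply/andP; split.
  by apply/bigmax_leqP => A /asboolP; exact: nd_para_free_card.
rewrite -card_axes_cross.
apply: (leq_bigmax_cond (F := fun A => #|pred_of_set A|)).
by apply/asboolP; exact: axes_cross_nd_para_free.
Qed.
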